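(* Let $\mathcal{F}$ be a free filter on $\mathbb{N}$. The following conditions are equivalent: (1) $\mathcal{F}$ is a strong $P$-filter. (2) $\mathcal{F}$ is Menger at infinity. (3) $K(\mathcal{F})$ is hereditarily Baire. (4) $\mathcal{F}^+$ is Menger.
   Context: Here $\mathbb{N}=\{0,1,2,\dots\}$. A filter on $\mathbb{N}$ is a family $\mathcal{F}$ of subsets of $\mathbb{N}$ with $\emptyset\notin\mathcal{F}$, $\mathbb{N}\in\mathcal{F}$, closed under supersets and under finite intersections; it is free if it contains all cofinite subsets of $\mathbb{N}$. Put $\mathcal{F}^\ast=\{A\subseteq\mathbb{N}:\mathbb{N}\setminus A\in\mathcal{F}\}$ and $\mathcal{F}^+=P(\mathbb{N})\setminus\mathcal{F}^\ast$. Identifying sets with characteristic functions, $P(\mathbb{N})$ is identified with the Cantor set $2^{\mathbb{N}}$ (product topology), and $\mathcal{F}$ and $\mathcal{F}^+$ are given the subspace topology. $\mathcal{F}$ is a strong $P$-filter if for any sequence $(\mathcal{C}_n)_{n\in\mathbb{N}}$ of compact subsets of $\mathcal{F}$ there is a sequence $0=k_0<k_1<k_2<\dots$ of natural numbers such that $\bigcup_{n\in\mathbb{N}}(X_n\cap[k_n,k_{n+1}))\in\mathcal{F}$ whenever $X_n\in\mathcal{C}_n$ for each $n\in\mathbb{N}$. A space $Y$ is Menger if for every sequence $(\mathcal{U}_n)_{n\in\omega}$ of open covers of $Y$ there are finite subfamilies $\mathcal{V}_n\subseteq\mathcal{U}_n$ such that $\bigcup_{n\in\omega}\mathcal{V}_n$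 covers $Y$. A Tychonoff space $Y$ is Menger at infinity if for some (equivalently, for every) Hausdorff compactification $bY$ of $Y$ the remainder $bY\setminus Y$ is Menger. $K(Y)$ denotes the space of all nonempty compact subsets of $Y$ with the Vietoris topology, whose basic open sets are $\langle U_0,\dots,U_n\rangle=\{K\in K(Y): K\subseteq\bigcup_{i\le n}U_i \text{ and } K\cap U_i\ne\emptyset \text{ for every } i\le n\}$, with each $U_i$ open in $Y$. A topological space is Baire if the intersection of every countable family of open dense subsets is dense; it is hereditarily Baire if every closed subspace is Baire. *)

(* Defs.v *)
From HB Require Import structures.
From mathcomp Require Import all_boot all_order.
From mathcomp Require Import all_classical all_reals all_analysis.

Set Implicit Arguments.
Unset Strict Implicit.
Unset Printing Implicit Defensive.

Local Open Scope classical_set_scope.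

(* [ProperFilter F] is exactly "a filter on [nat]" in the usual sense: it omits
   the empty set, contains [setT], and is closed under finite intersections and
   supersets. *)
Definition free_filter (F : set_system nat) : Prop :=
  forall A : set nat, finite_set (~` A) -> F A.

Definition dual_ideal (F : set_system nat) : set_system nat :=
  [set A | F (~` A)].

Definition positive (F : set_system nat) : set_system nat :=
  ~` dual_ideal F.

(* A point of the Cantor space is the characteristic function of the set
   [supp x]; every set arises from exactly one point. *)
Definition supp (x : cantor_space) : set nat := [set i | x i].

(* A family of subsets of [nat] as a subset of the Cantor space. Coerced to a
   type ([set_type]), it carries the subspace topology. *)
Definition in_cantor (G : set_system nat) : set cantor_space :=
  [set x | G (supp x)].

Definition strong_P_filter (F : set_system nat) : Prop :=
  forall C : nat -> set cantor_space,
    (forall n, compact (C n) /\ C n `<=` in_cantor F) ->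
    exists k : nat -> nat,
      [/\ k 0 = 0,
          forall n, k n < k n.+1
        & forall X : nat -> cantor_space, (forall n, C n (X n)) ->
            F (\bigcup_n (supp (X n) `&` [set i | k n <= i < k n.+1]))].

Definition open_cover (Y : topologicalType) (U : set (set Y)) : Prop :=
  U `<=` open /\ \bigcup_(A in U) A = setT.

Definition menger (Y : topologicalType) : Prop :=
  forall U : nat -> set (set Y), (forall n, open_cover (U n)) ->
    exists V : nat -> set (set Y),
      (forall n, V n `<=` U n /\ finite_set (V n)) /\
      \bigcup_n \bigcup_(A in V n) A = setT.

Definition embedding (X Y : topologicalType) (e : X -> Y) : Prop :=
  injective e /\
  forall A : set X, open A <-> exists2 B : set Y, open B & e @^-1` B = A.

Definition hausdorff_compactification (Y bY : topologicalType) (e : Y -> bY) :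
    Prop :=
  [/\ compact [set: bY], hausdorff_space bY, embedding e & dense (range e)].

Definition menger_at_infinity (Y : topologicalType) : Prop :=
  exists (bY : topologicalType) (e : Y -> bY),
    hausdorff_compactification e /\ menger (set_type (~` range e)).

Definition baire (Y : topologicalType) : Prop :=
  forall O : nat -> set Y, (forall n, open (O n) /\ dense (O n)) ->
    dense (\bigcap_n O n).

Definition hereditarily_baire (Y : topologicalType) : Prop :=
  forall A : set Y, closed A -> baire (set_type A).

Definition hyperspace (Y : topologicalType) : Type :=
  set_type [set K : set Y | compact K /\ K !=set0].

HB.instance Definition _ (Y : topologicalType) :=
  Choice.copy (hyperspace Y)
    (set_type [set K : set Y | compact K /\ K !=set0]).

Section Vietoris.
Variable Y : topologicalType.

(* [(n, U)] stands for the tuple [U 0, ..., U n]; the values [U i] with [n < i]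
   are irrelevant. *)
Definition vietoris_index : set (nat * (nat -> set Y)) :=
  [set p | forall i, i <= p.1 -> open (p.2 i)].

Definition vietoris_base (p : nat * (nat -> set Y)) : set (hyperspace Y) :=
  [set K | set_val K `<=` \bigcup_(i in [set i | i <= p.1]) p.2 i /\
           forall i, i <= p.1 -> set_val K `&` p.2 i !=set0].

Lemma vietoris_base_cover :
  \bigcup_(p in vietoris_index) vietoris_base p = setT.
Proof.
apply/seteqP; split => // K _; exists (0, fun=> setT).
  by move=> i _; exact: openT.
split => /= [x _|i _]; first by exists 0.
by have [_ [x Kx]] := set_valP K; exists x.
Qed.

Lemma vietoris_base_join p q (K : hyperspace Y) :
    vietoris_index p -> vietoris_index q ->
    vietoris_base p K -> vietoris_base q K ->
  exists r, [/\ vietoris_index r, vietoris_base r K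
    & vietoris_base r `<=` vietoris_base p `&` vietoris_base q].
Proof.
case: p q => [m U] [n V]; rewrite /vietoris_index /vietoris_base /=.
move=> oU oV [KU KUi] [KV KVi].
set bU := \bigcup_(i in _) U i; set bV := \bigcup_(i in _) V i.
have obU : open bU by apply: bigcup_open => i; exact: oU.
have obV : open bV by apply: bigcup_open => i; exact: oV.
pose W i := if i <= m then U i `&` bV else V (i - m.+1) `&` bU.
have WU i : i <= m -> W i = U i `&` bV by rewrite /W => ->.
have WV j : W (m.+1 + j) = V j `&` bU.
  by rewrite /W addSn ltnNge leq_addr/= -addSn addKn.
have sub i : i <= m + n.+1 ->
    i <= m \/ exists2 j, j <= n & i = m.+1 + j.
  move=> imn; have [|mi] := leqP i m; first by left.
  right; exists (i - m.+1); last by rewrite subnKC.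
  by rewrite leq_subLR addSnnS.
have um i : i <= m -> i <= m + n.+1 by move=> /leq_trans; apply; exact: leq_addr.
have un j : j <= n -> m.+1 + j <= m + n.+1 by rewrite addSnnS leq_add2l.
exists (m + n.+1, W); split => /=.
- move=> i /sub[im|[j jn ->]]; first by rewrite WU //; apply: openI => //; exact: oU.
  by rewrite WV; apply: openI => //; exact: oV.
- split=> [x Kx|i /sub[im|[j jn ->]]].
  + have [i im Uix] := KU _ Kx; exists i; first exact: um.
    by rewrite WU //; split => //; exact: KV.
  + rewrite WU //; have [x [Kx Ux]] := KUi _ im.
    by exists x; split => //; split => //; exact: KV.
  + rewrite WV; have [x [Kx Vx]] := KVi _ jn.
    by exists x; split => //; split => //; exact: KU.
- move=> L [/= LW LWi]; split; split => /=.
  + move=> x /LW[i /= /sub[im|[j jn ->]]]; last by rewrite WV => -[].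
    by rewrite WU // => -[Ux _]; exists i.
  + by move=> i im; have := LWi _ (um _ im); rewrite WU // => -[x [? []]]; exists x.
  + move=> x /LW[i /= /sub[im|[j jn ->]]]; first by rewrite WU // => -[].
    by rewrite WV => -[Vx _]; exists j.
  + by move=> j jn; have := LWi _ (un _ jn); rewrite WV => -[x [? []]]; exists x.
Qed.

HB.instance Definition _ := isBaseTopological.Build (hyperspace Y)
  vietoris_base_cover vietoris_base_join.

End Vietoris.

(* Main.v *)
Require Import Defs.
From HB Require Import structures.
From mathcomp Require Import all_boot all_order finmap.
From mathcomp Require Import all_classical all_reals all_analysis.

Set Implicit Arguments.
Unset Strict Implicit.
Unset Printing Implicit Defensive.

Local Open Scope classical_set_scope.

(** Every condition is equivalent to the following property of the subset [A] of
    the Cantor space that represents the filter: for all compact sets [K n]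
    contained in [A] there are [f n] such that every point agreeing, for each
    [n], with some point of [K n] below [f n] lies in [A]. Taking complements,
    this is the Menger property of the complement of [A], hence of the remainder
    of [A] in the Cantor space, and complementation of subsets of [nat] carries
    that remainder onto the positive sets. For a strong P-filter the bounds
    [f n] are the endpoints of the blocks; conversely one uses the upward
    closures of the finite meets.

    For hereditary Baireness, a Hurewicz-type argument shows that the player
    choosing the [K n] has no winning strategy in the corresponding game; a play
    lost against the strategy that runs through the given dense open sets yields
    compact sets converging to a compact subset of [A] in their intersection.
    Conversely, if the property fails, a tree of compact sets forms a countable
    closed subspace of the hyperspace without isolated points. *)

(** * Cylinders of the Cantor space *)

Definition agree (m : nat) (x y : cantor_space) : Prop :=
  forall i, i < m -> x i = y i.

(** The union of the cylinders of length [m] that meet [K]; for compact [K] these clopen sets form a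
    neighbourhood base of [K]. *)
Definition thick (m : nat) (K : set cantor_space) : set cantor_space :=
  [set x | exists2 y, K y & agree m x y].

Lemma agree_sym m x y : agree m x y -> agree m y x.
Proof. by move=> xy i /xy. Qed.

Lemma agree_trans m x y z : agree m x y -> agree m y z -> agree m x z.
Proof. by move=> xy yz i im; rewrite xy // yz. Qed.

Lemma agree_le m n x y : m <= n -> agree n x y -> agree m x y.
Proof. by move=> mn xy i im; apply: xy; exact: leq_trans mn. Qed.

Lemma nbhs_coord (x : cantor_space) i : \forall y \near x, y i = x i.
Proof.
apply: (@proj_continuous nat (fun=> bool) i x [set b | b = x i]).
by rewrite nbhs_principalE.
Qed.

Lemma nbhs_agree m (x : cantor_space) : \forall y \near x, agree m y x.
Proof.
elim: m => [|m IH]; first by near=> y => i.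
have xm := nbhs_coord x m.
near=> y => i; rewrite ltnS leq_eqVlt => /orP[/eqP ->|im].
  by near: y; exact: xm.
have : agree m y x by near: y; exact: IH.
exact.
Unshelve. all: by end_near. Qed.

Lemma nbhs_cantorP (x : cantor_space) (U : set cantor_space) :
  nbhs x U <-> exists m, forall y, agree m y x -> U y.
Proof.
split; last by case=> m mU; apply: filterS (nbhs_agree m x).
pose G := filter_from [set: nat] (fun m => [set y : cantor_space | agree m y x]).
have FG : ProperFilter G.
  apply: filter_from_proper; last by move=> m _; exists x.
  apply: filter_from_filter; first by exists 0.
  move=> m n _ _; exists (maxn m n) => // y /= yx.
  by split; apply: agree_le yx; rewrite ?leq_maxl ?leq_maxr.
have Gx : G --> x.
  apply/(@pointwise_cvgP nat bool G x) => i V /=.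
  rewrite nbhs_principalE => Vx; exists i.+1 => // y /= yx.
  by rewrite yx; [exact: Vx|].
by move=> /Gx[m _ mU]; exists m.
Qed.

Lemma thick_sub m K : K `<=` thick m K.
Proof. by move=> x Kx; exists x. Qed.

Lemma thickS m K L : K `<=` L -> thick m K `<=` thick m L.
Proof. by move=> KL x [y /KL Ly xy]; exists y. Qed.

Lemma thick_le m n K : m <= n -> thick n K `<=` thick m K.
Proof. by move=> mn x [y Ky xy]; exists y => //; exact: agree_le xy. Qed.

Lemma thick_thick m n K : thick m (thick n K) `<=` thick (minn m n) K.
Proof.
move=> x [y [z Kz yz] xy]; exists z => //.
by apply: (@agree_trans _ _ y);
  [apply: agree_le xy; exact: geq_minl | apply: agree_le yz; exact: geq_minr].
Qed.

Lemma thick_eq_le m n K L : m <= n ->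
  thick n K = thick n L -> thick m K = thick m L.
Proof.
move=> mn KL; apply/seteqP; split => x [y Ky xy].
  have : thick n K y by exact: thick_sub.
  rewrite KL => -[z Lz yz]; exists z => //.
  by apply: (agree_trans xy); exact: agree_le yz.
have : thick n L y by exact: thick_sub.
rewrite -KL => -[z Lz yz]; exists z => //.
by apply: (agree_trans xy); exact: agree_le yz.
Qed.

Lemma thick_agree m K x y : agree m x y -> thick m K y -> thick m K x.
Proof. by move=> xy [z Kz yz]; exists z => //; exact: agree_trans yz. Qed.

Lemma clopen_thick m K : clopen (thick m K).
Proof.
split; first rewrite openE => x Kx /=.
  by apply/nbhs_cantorP; exists m => y yx; exact: thick_agree Kx.
move=> x clx; have [y [Ky yx]] := clx _ (nbhs_agree m x).
by apply: thick_agree Ky; exact: agree_sym.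
Qed.

Lemma closed_compact_cantor (K : set cantor_space) : closed K -> compact K.
Proof.
by move=> cK; apply: subclosed_compact cK cantor_space_compact _.
Qed.

Lemma compact_closed_cantor (K : set cantor_space) : compact K -> closed K.
Proof. exact: compact_closed cantor_space_hausdorff. Qed.

Lemma closed_thickP (K : set cantor_space) x :
  closed K -> (forall m, thick m K x) -> K x.
Proof.
move=> cK Kx; apply: cK => U /nbhs_cantorP[m mU].
by have [y Ky xy] := Kx m; exists y; split => //; exact/mU/agree_sym.
Qed.

Lemma compact_thick_sub (K U : set cantor_space) :
  compact K -> open U -> K `<=` U -> exists m, thick m K `<=` U.
Proof.
move=> /compact_near_coveringP cK oU KU.
have [|m _ mU] := cK nat \oo (fun m x => forall z, agree m z x -> U z) _.
  move=> x /KU Ux; have /nbhs_cantorP[m mU] : nbhs x U by exact: open_nbhs_nbhs.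
  exists ([set y | agree m y x], [set n | m <= n]) => /=.
    by split; [exact: nbhs_agree | exists m].
  move=> [y n] [/= yx mn] z zy; apply: mU.
  by apply: agree_trans yx; exact: agree_le zy.
by exists m => x [y Ky xy]; exact: (mU m (leqnn m) y Ky).
Qed.

Lemma nested_closed_sub (D : nat -> set cantor_space) (U : set cantor_space) :
    (forall k, closed (D k)) -> (forall j k, j <= k -> D k `<=` D j) ->
    open U -> \bigcap_k D k `<=` U ->
  exists k, D k `<=` U.
Proof.
move=> cD Ddec oU DU.
have /compact_near_coveringP cT := cantor_space_compact.
have [|k _ kU] := cT nat \oo (fun k x => D k x -> U x) _.
  move=> x _; have [Ux|nUx] := pselect (U x).
    exists (U, setT) => /=; first by split; [exact: open_nbhs_nbhs | exact: filterT].
    by move=> [y n] [].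
  have [k nDk] : exists k, ~ D k x.
    by apply/existsNP => Dx; apply: nUx; apply: DU => k _.
  exists (~` D k, [set n | k <= n]) => /=.
    split; last by exists k.
    by apply: open_nbhs_nbhs; split => //; exact: closed_openC.
  by move=> [y n] [/= nDy kn] /(Ddec _ _ kn).
by exists k => x; exact: (kU k (leqnn k) x).
Qed.

(** With a general [g], one continuity proof covers intersection, union and complement. *)
Definition pointwise (g : nat -> bool -> bool -> bool)
  (p : cantor_space * cantor_space) : cantor_space := fun i => g i (p.1 i) (p.2 i).

Lemma pointwise_continuous g : continuous (pointwise g).
Proof.
move=> p U /= /nbhs_cantorP[m mU].
exists ([set y | agree m y p.1], [set y | agree m y p.2]) => /=.
  by split; exact: nbhs_agree.
move=> [y z] [/= yp zp]; apply: mU => i im.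
by rewrite /pointwise /= yp // zp.
Qed.

Lemma compact_pointwise g A B :
  compact A -> compact B -> compact (pointwise g @` (A `*` B)).
Proof.
move=> cA cB; apply: continuous_compact; last exact: compact_setX.
by apply: continuous_subspaceT; exact: pointwise_continuous.
Qed.

(** * The selection property dual to the Menger property *)

Definition shrinkable (A : set cantor_space) : Prop :=
  forall K : nat -> set cantor_space,
    (forall n, compact (K n) /\ K n `<=` A) ->
    exists f : nat -> nat, \bigcap_n thick (f n) (K n) `<=` A.

Lemma set_type_openP (T : topologicalType) (A : set T) (V : set (set_type A)) :
  open V <-> exists2 B : set T, open B & set_val @^-1` B = V.
Proof. by []. Qed.

(** Outside the union [W n] of the ambient extensions of the [n]-th cover there remains a compact
    subset of [A]. The complement of its clopen thickening is compact and inside [W n], so finitely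
    many members cover it, and by the choice of [f] these complements cover that of [A]. *)
Lemma shrinkable_menger (A : set cantor_space) :
  shrinkable A -> menger (set_type (~` A)).
Proof.
move=> sA U Ucov.
pose I n := [set B : set cantor_space | open B /\ U n (set_val @^-1` B)].
pose W n := \bigcup_(B in I n) B.
have oW n : open (W n) by apply: bigcup_open => B [].
have WA n : ~` W n `<=` A.
  move=> x nWx; apply: contrapT => nAx; apply: nWx.
  have [Uo UT] := Ucov n.
  pose x' : set_type (~` A) := exist _ x (mem_set nAx).
  have : (\bigcup_(V in U n) V) x' by rewrite UT.
  case=> V UV Vx; have [B oB BV] := (set_type_openP V).1 (Uo _ UV).
  exists B; first by split => //; rewrite BV.
  by move: Vx; rewrite -BV.
have [n|f fA] := sA (fun n => ~` W n).
  split; last exact: WA.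
  by apply: closed_compact_cantor; exact: open_closedC.
have fin n : exists D : set (set cantor_space),
    [/\ finite_set D, D `<=` I n & ~` thick (f n) (~` W n) `<=` \bigcup_(B in D) B].
  have : compact (~` thick (f n) (~` W n)).
    by apply: closed_compact_cantor; apply: open_closedC; exact: (clopen_thick _ _).1.
  rewrite compact_cover => /(_ (set cantor_space) (I n) id).
  case=> [B []//|x nx|D DI Dcov].
    have : W n x.
      by apply: contrapT => nWx; apply: nx; exact: thick_sub.
    by case=> B IB Bx; exists B.
  exists [set` D]; split => //; first exact: finite_fset.
  by move=> B DB; have /set_mem := DI B DB.
have [D DP] := choice fin.
exists (fun n => [set set_val @^-1` B | B in D n]); split.
  move=> n; have [Df DI _] := DP n; split.
    by move=> _ [B /DI[_ UB] <-].
  exact: finite_image.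
apply/seteqP; split => // x _.
have [n nx] : exists n, ~ thick (f n) (~` W n) (set_val x).
  apply/existsNP => fx; have := set_valP x; apply; apply: fA => n _; exact: fx.
have [_ _ /(_ _ nx)[B DB Bx]] := DP n.
by exists n => //; exists (set_val @^-1` B) => //; exists B.
Qed.

(** For fixed [n] the complements of [thick m (K n)] increase with [m], so a finite subfamily lies
    in a single one, whose index is [f n]. *)
Lemma menger_shrinkable (A : set cantor_space) :
  menger (set_type (~` A)) -> shrinkable A.
Proof.
move=> mA K KA.
pose O n m : set (set_type (~` A)) := set_val @^-1` (~` thick m (K n)).
have Oincr n i j : i <= j -> O n i `<=` O n j.
  by move=> ij x nx tx; apply: nx; exact: thick_le tx.
have [n|V [VU VT]] := mA (fun n => range (O n)).
  split.
    move=> _ [m _ <-]; apply/set_type_openP; exists (~` thick m (K n)) => //.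
    by apply: closed_openC; exact: (clopen_thick _ _).2.
  apply/seteqP; split => // x _.
  have [m nKx] : exists m, ~ thick m (K n) (set_val x).
    apply/existsNP => Kx; apply: (set_valP x); apply: (KA n).2.
    by apply: closed_thickP Kx; apply: compact_closed_cantor; exact: (KA n).1.
  by exists (O n m) => //; exists m.
have fin n : exists m, forall B, V n B -> B `<=` O n m.
  have [VO Vf] := VU n.
  have VO' B : exists m, V n B -> B = O n m.
    have [/VO[m _ <-]|nB] := pselect (V n B); first by exists m.
    by exists 0.
  have [idx idxP] := choice VO'.
  have [s sV] := (finite_seqP _).1 Vf.
  exists (\max_(B <- s) idx B) => B VB; rewrite {1}(idxP B VB).
  apply: Oincr; apply: (@leq_bigmax_seq _ s xpredT idx) => //.
  by move: VB; rewrite sV.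
have [f fP] := choice fin.
exists f => x fx; apply: contrapT => nAx.
pose x' : set_type (~` A) := exist _ x (mem_set nAx).
have : (\bigcup_n \bigcup_(B in V n) B) x' by rewrite VT.
case=> n _ [B VB Bx]; have := fP n B VB _ Bx; apply; exact: fx.
Qed.

(** * Strong P-filters *)

Definition charf (E : set nat) : cantor_space := fun i => `[< E i >].

Lemma supp_charf E : supp (charf E) = E.
Proof. by apply/seteqP; split => i /asboolP. Qed.

Lemma block_exists (k : nat -> nat) n i : k 0 = 0 ->
  i < k n.+1 -> exists2 j, j <= n & k j <= i < k j.+1.
Proof.
move=> k0; elim: n => [ik|n IH ik]; first by exists 0; rewrite // k0.
have [/IH[j jn jk]|ki] := ltnP i (k n.+1); first by exists j => //; exact: leqW.
by exists n.+1 => //; rewrite ki.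
Qed.

Lemma increasing_ge (k : nat -> nat) n : (forall n, k n < k n.+1) -> n <= k n.
Proof. by move=> kS; elim: n => // n IH; exact: leq_ltn_trans IH (kS n). Qed.

(** A point that agrees with [X n] below [k n.+1] for every [n] is the union of the blocks of the
    [X n]. *)
Lemma strong_P_shrinkable (F : set_system nat) :
  strong_P_filter F -> shrinkable (in_cantor F).
Proof.
move=> sP K KF; have [k [k0 kS kF]] := sP K KF.
exists (fun n => k n.+1) => x xK.
have /choice[X XP] : forall n, exists y, K n y /\ agree (k n.+1) x y.
  by move=> n; have [y Ky xy] := xK n I; exists y.
have -> : x = charf (\bigcup_n (supp (X n) `&` [set i | k n <= i < k n.+1])).
  apply/funext => i; apply/idP/asboolP.
    move=> xi; have ik : i < k i.+1 by exact: increasing_ge.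
    have [j _ /[dup] jk /andP[_ ij]] := block_exists k0 ik.
    by exists j => //; split => //; rewrite /supp /= -(XP j).2.
  by case=> n _ [Xi /andP[_ ik]]; rewrite (XP n).2.
rewrite /in_cantor /= supp_charf; apply: kF => n; exact: (XP n).1.
Qed.

(** Passing to these meets lets one point of stage [n] control all blocks up to the [n]-th at
    once. *)
Fixpoint meets (C : nat -> set cantor_space) n : set cantor_space :=
  if n is n'.+1 then pointwise (fun=> andb) @` (meets C n' `*` C n) else C 0.

Fixpoint meet_seq (X : nat -> cantor_space) n : cantor_space :=
  if n is n'.+1 then pointwise (fun=> andb) (meet_seq X n', X n) else X 0.

Lemma meet_seq_meets C X n : (forall n, C n (X n)) -> meets C n (meet_seq X n).
Proof.
by move=> CX; elim: n => //= n IH; exists (meet_seq X n, X n.+1).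
Qed.

Lemma meet_seq_le X n j i : j <= n -> meet_seq X n i -> X j i.
Proof.
elim: n => [|n IH]; first by rewrite leqn0 => /eqP ->.
rewrite leq_eqVlt => /orP[/eqP ->|jn] /= /andP[mi Xi] //.
exact: IH.
Qed.

Lemma compact_meets C n : (forall n, compact (C n)) -> compact (meets C n).
Proof. by move=> cC; elim: n => //= n IH; exact: compact_pointwise. Qed.

Lemma meets_sub (F : set_system nat) C n : Filter F ->
  (forall n, C n `<=` in_cantor F) -> meets C n `<=` in_cantor F.
Proof.
move=> FF CF; elim: n => [|n IH]; first exact: CF.
move=> _ [[x y] /= [/IH Fx /CF Fy] <-]; rewrite /in_cantor /=.
apply: filterS (filterI Fx Fy) => i [/= xi yi].
by rewrite /supp /pointwise /=; apply/andP; split.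
Qed.

(** Joining with arbitrary sets gives upward closures, still compact and inside the filter. Below
    [k n.+1] the union [E] of the blocks agrees with its join with the meet of [X 0, ..., X n]: an
    element of the meet lies in some block [j <= n] and in [X j], hence in [E]. *)
Lemma shrinkable_strong_P (F : set_system nat) : Filter F ->
  shrinkable (in_cantor F) -> strong_P_filter F.
Proof.
move=> FF sF C CF.
pose K n := pointwise (fun=> orb) @` (meets C n `*` [set: cantor_space]).
have [n|f fF] := sF K.
  split.
    apply: compact_pointwise cantor_space_compact.
    by apply: compact_meets => m; exact: (CF m).1.
  move=> _ [[x y] /= [mx _] <-].
  have Fx : in_cantor F x by apply: (meets_sub FF) mx => m; exact: (CF m).2.
  by apply: filterS Fx => i xi; apply/orP; left.
pose k := fix k n := if n is n'.+1 then maxn (f n') (k n').+1 else 0.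
have kS n : k n < k n.+1 by rewrite /= leq_max leqnn orbT.
exists k; split => // X CX.
set E := \bigcup_n _.
have : in_cantor F (charf E); last by rewrite /in_cantor /= supp_charf.
apply: fF => n _; apply: (@thick_le _ (k n.+1)); first by rewrite /= leq_maxl.
exists (pointwise (fun=> orb) (meet_seq X n, charf E)).
  by exists (meet_seq X n, charf E) => //; split => //=; exact: meet_seq_meets.
move=> i ik; rewrite /pointwise /=.
case mi : (meet_seq X n i) => //=.
have [j jn jk] := block_exists (erefl : k 0 = 0) ik.
apply/asboolP; exists j => //; split => //; exact: meet_seq_le mi.
Qed.

(** * Complementation and the positive sets *)

Definition flip : cantor_space -> cantor_space := fun x i => ~~ x i.

Lemma flipK : involutive flip.
Proof. by move=> x; apply/funext => i; rewrite /flip negbK. Qed.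

Lemma agree_flip m x y : agree m x y -> agree m (flip x) (flip y).
Proof. by move=> xy i im; rewrite /flip xy. Qed.

Lemma compact_flip K : compact K -> compact (flip @` K).
Proof.
move=> cK.
have -> : flip @` K = pointwise (fun _ a _ => ~~ a) @` (K `*` K).
  apply/seteqP; split => [_ [x Kx <-]|_ [[x y] /= [Kx _] <-]].
    by exists (x, x).
  by exists x.
exact: compact_pointwise.
Qed.

Lemma shrinkable_flip A : shrinkable A -> shrinkable (flip @^-1` A).
Proof.
move=> sA K KA; have [n|f fA] := sA (fun n => flip @` K n).
  split; first by apply: compact_flip; exact: (KA n).1.
  by move=> _ [x /(KA n).2 Ax <-].
exists f => x fx; apply: fA => n _; have [y Ky xy] := fx n I.
by exists (flip y); [exists y | exact: agree_flip].
Qed.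

Lemma in_cantor_positive F :
  in_cantor (positive F) = ~` (flip @^-1` in_cantor F).
Proof.
suff E x : supp (flip x) = ~` supp x.
  by apply/seteqP; split => x; rewrite /in_cantor /= E.
by apply/seteqP; split => i; rewrite /supp /flip /= => /negP.
Qed.

Lemma shrinkable_menger_positive F :
  shrinkable (in_cantor F) -> menger (set_type (in_cantor (positive F))).
Proof.
by move=> /shrinkable_flip sF; rewrite in_cantor_positive; exact: shrinkable_menger.
Qed.

Lemma menger_positive_shrinkable F :
  menger (set_type (in_cantor (positive F))) -> shrinkable (in_cantor F).
Proof.
rewrite in_cantor_positive => /menger_shrinkable/shrinkable_flip.
congr (shrinkable _); apply/seteqP; split => x; by rewrite /= flipK.
Qed.

(** * Compactifications *)

Lemma compact_preimage_val (T : topologicalType) (A K : set T) :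
  compact K -> K `<=` A -> compact (set_val @^-1` K : set (set_type A)).
Proof.
move=> cK KA G PG GK.
have [x [Kx clx]] := cK (set_val @ G) _ GK.
exists (exist _ x (mem_set (KA _ Kx))); split => // B V GB.
case=> _ [[W oW <-] Wx WV].
have [_ [[y By <-] Wy]] : (set_val @` B) `&` W !=set0.
  apply: clx; last exact: open_nbhs_nbhs.
  by apply: (@filterS _ G _ B) => // y By; exists y.
by exists y; split => //; exact: WV.
Qed.

Lemma embedding_continuous (X Y : topologicalType) (e : X -> Y) :
  embedding e -> continuous e.
Proof. by move=> [_ eo]; apply/continuousP => B oB; apply/eo; exists B. Qed.

Lemma set_val_embedding (T : topologicalType) (A : set T) :
  embedding (set_val : set_type A -> T).
Proof. by split; [exact: val_inj | move=> V; exact: set_type_openP]. Qed.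

Lemma range_set_val (T : Type) (A : set T) :
  range (set_val : set_type A -> T) = A.
Proof.
apply/seteqP; split => [_ [x _ <-]|x Ax]; first exact: set_valP.
by exists (exist _ x (mem_set Ax)).
Qed.

Lemma shrinkable_menger_at_infinity (A : set cantor_space) :
  dense A -> shrinkable A -> menger_at_infinity (set_type A).
Proof.
move=> dA sA; exists cantor_space, set_val; split.
  split; [exact: cantor_space_compact | exact: cantor_space_hausdorff
    | exact: set_val_embedding | by rewrite range_set_val].
by rewrite range_set_val; exact: shrinkable_menger.
Qed.

(** As [bY] is arbitrary, it is compared with the Cantor space through filters. The remainder is
    covered by open sets whose closures miss the compact image of [K n]; finitely many of these
    closures form a closed set [C n], and [f n] is chosen so that points of [A] in
    [thick (f n) (K n)] are mapped off [C n]. *)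
Lemma menger_at_infinity_shrinkable (A : set cantor_space) :
  dense A -> menger_at_infinity (set_type A) -> shrinkable A.
Proof.
move=> dA [bY [e [[cbY hbY emb _] mR]]] K KA.
have econt := embedding_continuous emb.
pose eK n := e @` (set_val @^-1` K n).
have ceK n : closed (eK n).
  apply: (compact_closed hbY); apply: continuous_compact.
    exact: continuous_subspaceT.
  by apply: compact_preimage_val; [exact: (KA n).1 | exact: (KA n).2].
pose good n (B : set bY) := open B /\ closure B `<=` ~` eK n.
pose U n := [set V : set (set_type (~` range e)) |
  exists2 B, good n B & V = set_val @^-1` B].
have [n|V [VU VT]] := mR U.
  split; first by move=> _ [B [oB _] ->]; apply/set_type_openP; exists B.
  apply/seteqP; split => // z _.
  have nz : nbhs (set_val z) (~` eK n).
    apply: open_nbhs_nbhs; split; first exact: closed_openC.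
    by move=> [y _ yz]; apply: (set_valP z); exists y.
  have reg : regular_space bY.
    move=> x; apply: (@compact_regular bY x setT) => //; exact: filterT.
  have [N zN Nsub] := reg _ _ nz.
  exists (set_val @^-1` N°); last exact: zN.
  exists N° => //; split; first exact: open_interior.
  by apply: subset_trans Nsub; apply: closureS; exact: interior_subset.
have VB n W : exists B, V n W -> good n B /\ W = set_val @^-1` B.
  have [/(VU n).1[B gB ->]|nW] := pselect (V n W); first by exists B.
  by exists set0.
have [Bof BofP] : exists Bof : nat -> set (set_type (~` range e)) -> set bY,
    forall n W, V n W -> good n (Bof n W) /\ W = set_val @^-1` (Bof n W).
  have [|Bof BofP] := @choice _ _ (fun n g => forall W, V n W ->
      good n (g W) /\ W = set_val @^-1` g W); last by exists Bof.
  by move=> n; have [g gP] := choice (VB n); exists g.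
pose C n := \bigcup_(W in V n) closure (Bof n W).
have cC n : closed (C n).
  by apply: closed_bigcup; [exact: (VU n).2 | move=> W _; exact: closed_closure].
have fex n : exists m, forall y : set_type A,
    thick m (K n) (set_val y) -> ~ C n (e y).
  have oeC : open (e @^-1` (~` C n)).
    by move/continuousP: econt; apply; exact: closed_openC.
  have [Q oQ QC] := (set_type_openP _).1 oeC.
  have [|m mO] := compact_thick_sub (KA n).1 oQ.
    move=> x Kx; pose y : set_type A := exist _ x (mem_set ((KA n).2 _ Kx)).
    have : (e @^-1` (~` C n)) y; last by rewrite -QC.
    move=> [W VW]; have [[_ gW] _] := BofP n W VW.
    by move=> /gW; apply; exists y.
  by exists m => y /mO Qy; have : (set_val @^-1` Q) y by []; rewrite QC.
have [f fP] := choice fex; exists f => x xK.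
(* Density of [A] makes the trace of every neighbourhood of [x] nonempty, so [G] is proper and
   clusters in [bY]. *)
pose G := filter_from (nbhs x) (fun N => e @` (set_val @^-1` N)).
have PG : ProperFilter G.
  apply: filter_from_proper.
    apply: filter_from_filter; first by exists setT; exact: filterT.
    move=> M N xM xN; exists (M `&` N); first exact: filterI.
    by move=> _ [y [My Ny] <-]; split; exists y.
  move=> N; rewrite nbhsE => -[Q [oQ Qx] QN].
  have [|y [Qy Ay]] := dA Q _ oQ; first by exists x.
  pose y' : set_type A := exist _ y (mem_set Ay).
  by exists (e y'); exists y' => //; exact: QN.
have [z [_ Gz]] := cbY G PG filterT.
(* If [z] is the image of [y] in [A], then [y] and [x] cannot be separated. *)
have [[y _ yz]|nz] := pselect (range e z).
  suff <- : set_val y = x by exact: set_valP.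
  apply: cantor_space_hausdorff => M N; rewrite nbhsE => -[Q [oQ Qy] QM] xN.
  have [B oB BQ] : exists2 B : set bY, open B & e @^-1` B = set_val @^-1` Q.
    by apply/emb.2; apply/set_type_openP; exists Q.
  have [_ [[w Nw <-] Bw]] : (e @` (set_val @^-1` N)) `&` B !=set0.
    apply: Gz; first by exists N.
    apply: open_nbhs_nbhs; split => //; rewrite -yz.
    by have : (set_val @^-1` Q) y by []; rewrite -BQ.
  exists (set_val w); split => //; apply: QM.
  by have : (e @^-1` B) w by []; rewrite BQ.
(* Otherwise a selected open set contains [z] and so meets the image of a thickening that avoids
   it. *)
pose z' : set_type (~` range e) := exist _ z (mem_set nz).
have : (\bigcup_n \bigcup_(W in V n) W) z' by rewrite VT.
case=> n _ [W VW]; have [[oB _] WE] := BofP n W VW; rewrite WE => Bz.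
have [_ [[w Kw <-] Bw]] :
    (e @` (set_val @^-1` thick (f n) (K n))) `&` Bof n W !=set0.
  apply: Gz; last exact: open_nbhs_nbhs.
  exists (thick (f n) (K n)) => //; apply: open_nbhs_nbhs; split; last exact: xK.
  exact: (clopen_thick _ _).1.
by case: (fP n w Kw); exists W => //; exact: subset_closure.
Qed.

(** * The hyperspace of a subspace of the Cantor space *)

Lemma vietoris_base_open (Y : topologicalType) p :
  @vietoris_index Y p -> open (vietoris_base p).
Proof.
move=> Ip; exists [set p]; first by move=> _ ->.
by rewrite bigcup_set1.
Qed.

Lemma vietoris_nbhsP (Y : topologicalType) (K : hyperspace Y) U :
  nbhs K U -> exists p,
    [/\ vietoris_index p, vietoris_base p K & vietoris_base p `<=` U].
Proof.
rewrite nbhsE => -[Q [[D DI <-] [p Dp Kp]] QU].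
exists p; split => //; first exact: DI.
by move=> L Lp; apply: QU; exists p.
Qed.

Lemma nbhs_subset_open (Y : topologicalType) (K : hyperspace Y) (U : set Y) :
  open U -> set_val K `<=` U -> \forall L \near K, set_val L `<=` U.
Proof.
move=> oU KU; pose p : nat * (nat -> set Y) := (0, fun=> U).
have Ip : vietoris_index p by [].
apply: (@filterS _ _ _ (vietoris_base p)).
  by move=> L [LU _] x /LU[].
apply: open_nbhs_nbhs; split; first exact: vietoris_base_open.
split => [x /KU Ux|i _]; first by exists 0.
have [_ [x Kx]] := set_valP K; exists x; split => //; exact: KU.
Qed.

Lemma nbhs_meets_open (Y : topologicalType) (K : hyperspace Y) (U : set Y) :
  open U -> set_val K `&` U !=set0 -> \forall L \near K, set_val L `&` U !=set0.
Proof.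
move=> oU KU; pose p : nat * (nat -> set Y) := (1, fun i => if i is 0 then U else setT).
have Ip : vietoris_index p by case=> [|i] _ //=; exact: openT.
apply: (@filterS _ _ _ (vietoris_base p)); first by move=> L [_ /(_ 0)]; exact.
apply: open_nbhs_nbhs; split; first exact: vietoris_base_open.
split => [x Kx|[|i] _ //=]; first by exists 1.
by have [x [Kx _]] := KU; exists x.
Qed.

Section Hyperspace.
Variable A : set cantor_space.
Local Notation HA := (hyperspace (set_type A)).

Definition img (K : HA) : set cantor_space := set_val @` set_val K.

Lemma compact_img K : compact (img K).
Proof.
have [cK _] := set_valP K; apply: continuous_compact cK.
by apply: continuous_subspaceT; exact: initial_continuous.
Qed.
Arguments compact_img : clear implicits.

Lemma img_sub K : img K `<=` A.
Proof. by move=> _ [x _ <-]; exact: set_valP. Qed.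

Lemma img_neq0 K : img K !=set0.
Proof. by have [_ [x Kx]] := set_valP K; exists (set_val x); exists x. Qed.

Lemma img_surj (K : set cantor_space) :
  compact K -> K `<=` A -> K !=set0 -> exists L : HA, img L = K.
Proof.
move=> cK KA [x Kx].
have KP : [set K : set (set_type A) | compact K /\ K !=set0] (set_val @^-1` K).
  split; first exact: compact_preimage_val.
  by exists (exist _ x (mem_set (KA _ Kx))).
exists (@exist _ (fun B => B \in _) _ (mem_set KP)).
apply/seteqP; split => [_ [y Ky <-] //|y Ky].
by exists (exist _ y (mem_set (KA _ Ky))).
Qed.

Lemma img_inj : injective img.
Proof.
move=> K L KL; apply: val_inj; apply/seteqP; split => x Kx.
  have : img K (set_val x) by exists x.
  by rewrite KL => -[y Ly /val_inj <-].
have : img L (set_val x) by exists x.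
by rewrite -KL => -[y Ly /val_inj <-].
Qed.

(** Finitely many points represent the cylinders of length [m] that meet [K]; being inside
    [thick m (img K)] and meeting each of these cylinders are open conditions on [L]. *)
Lemma nbhs_hyperspace_thick (K : HA) m :
  \forall L \near K, thick m (img L) = thick m (img K).
Proof.
have [s sK Ks] : exists2 s : seq cantor_space, (forall x, x \in s -> img K x) &
    (forall x, img K x -> exists2 y, y \in s & agree m x y).
  have := compact_img K.
  rewrite compact_cover => /(_ cantor_space (img K) (fun x => [set y | agree m y x])).
  case=> [x _|x Kx|D DK Kcov].
  - rewrite openE => y yx; apply/nbhs_cantorP; exists m => z zy.
    exact: agree_trans yx.
  - by exists x.
  - exists (enum_fset D) => [x xD|x /Kcov[y yD xy]]; last by exists y.
    by have /set_mem := DK x xD.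
have nsub : \forall L \near K, set_val L `<=` set_val @^-1` thick m (img K).
  apply: nbhs_subset_open.
    by apply/set_type_openP; exists (thick m (img K)) => //; exact: (clopen_thick _ _).1.
  by move=> x Kx; apply: thick_sub; exists x.
have nmeet : \forall L \near K, forall x, x \in s -> thick m (img L) x.
  elim: s sK {Ks} => [|x s IH] sK; first by near=> L.
  have nIH := IH (fun y ys => sK y (mem_behead (s := x :: s) ys)).
  have nx : \forall L \near K, set_val L `&` set_val @^-1` thick m [set x] !=set0.
    apply: nbhs_meets_open.
      by apply/set_type_openP; exists (thick m [set x]) => //; exact: (clopen_thick _ _).1.
    have [y Ky yx] := sK x (mem_head x s); exists y; split => //.
    by exists x => //; rewrite yx.
  apply: filterS2 nIH nx => L Ls [y [Ly [z zx yz]]] w.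
  rewrite inE => /orP[/eqP ->|/Ls //].
  by exists (set_val y); [exists y | rewrite -zx; exact: agree_sym].
apply: filterS2 nsub nmeet => L LK Ls; apply/seteqP; split => x.
  by move=> [_ [y /LK Ky <-] xy]; exact: thick_agree Ky.
move=> [y /Ks[z /Ls zL yz] xy]; apply: thick_agree zL.
exact: agree_trans yz.
Unshelve. all: by end_near. Qed.

(** Compactness gives one length for containment in the union and each of the finitely many sets to
    be met gives another; their maximum works. *)
Lemma nbhs_hyperspaceP (K : HA) U :
  nbhs K U <-> exists m, forall L, thick m (img L) = thick m (img K) -> U L.
Proof.
split; last by case=> m mU; apply: filterS (nbhs_hyperspace_thick K m).
move=> /vietoris_nbhsP[[n V] [/= oV [/= KV KVi] VU]].
have oval i : exists B : set cantor_space,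
    i <= n -> open B /\ set_val @^-1` B = V i.
  have [/oV /set_type_openP[B oB BV]|ni] := pselect (i <= n); first by exists B.
  by exists set0.
have [B BP] := choice oval.
have oB : open (\bigcup_(i in [set i | i <= n]) B i).
  by apply: bigcup_open => i /BP[].
have [|m1 m1P] := compact_thick_sub (compact_img K) oB.
  move=> _ [x Kx <-]; have [i im Vi] := KV _ Kx; exists i => //.
  by have : V i x by []; rewrite -(BP i im).2.
have meet i : exists m, i <= n -> exists2 x, img K x & forall y, agree m y x -> B i y.
  have [im|ni] := pselect (i <= n); last by exists 0.
  have [x [Kx Vx]] := KVi i im.
  have [oBi BV] := BP i im.
  have : nbhs (set_val x) (B i).
    apply: open_nbhs_nbhs; split => //.
    by have : V i x by []; rewrite -BV.
  move=> /nbhs_cantorP[m mB]; exists m => _; exists (set_val x) => //.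
  by exists x.
have [m2 m2P] := choice meet.
exists (maxn m1 (\max_(i < n.+1) m2 i)) => L LK; apply: VU; split => /=.
  move=> x Lx; have : thick m1 (img K) (set_val x).
    apply: (thick_le (leq_maxl m1 (\max_(i < n.+1) m2 i))).
    by rewrite -LK; apply: thick_sub; exists x.
  move=> /m1P[i im Bi]; exists i => //.
  by rewrite -(BP i im).2.
move=> i im; have [x Kx xB] := m2P i im.
have : thick (maxn m1 (\max_(i < n.+1) m2 i)) (img L) x.
  by rewrite LK; exact: thick_sub.
move=> [_ [y Ly <-] xy]; exists y; split => //.
rewrite -(BP i im).2; apply: xB; apply: agree_sym; apply: agree_le xy.
rewrite leq_max; apply/orP; right.
exact: (@leq_bigmax _ (fun i : 'I_n.+1 => m2 i) (Ordinal (im : i < n.+1))).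
Qed.

End Hyperspace.
Arguments compact_img {A} K.

(** * The selection game *)

Fixpoint past (sigma : nat -> nat) n : seq nat :=
  if n is n'.+1 then sigma n' :: past sigma n' else [::].

Lemma size_past sigma n : size (past sigma n) = n.
Proof. by elim: n => //= n ->. Qed.

(* A strategy [K] of the first player is indexed by the moves of the second
   one, the most recent move first. *)
Section Game.
Variable K : seq nat -> set cantor_space.

Fixpoint survivors (s : seq nat) : set cantor_space :=
  if s is m :: s' then survivors s' `&` thick m (K s') else setT.

Local Notation below k := (all (fun i : nat => i < k)).

(** Lower the earliest move that is at least [k] to [k] and forget the later ones; lowering a move
    enlarges the thickening. *)
Lemma survivors_split k s x : survivors s x ->
  below k s \/ exists s', [/\ size s' < size s, below k s' & survivors (k :: s') x].
Proof.
elim: s => [|m s IH]; first by left.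
move=> [/= /[dup] sx /IH[bs|[s' [ss' bs' s'x]]] mx]; last first.
  by right; exists s'; split => //; exact: leqW.
rewrite bs andbT; have [mk|km] := ltnP m k; first by left.
by right; exists s; split => //; split => //; exact: thick_le mx.
Qed.

(* The restriction to moves below [k] makes the union finite; by
   [survivors_split] it loses nothing. *)
Definition round n k : set cantor_space :=
  [set x | exists s, [/\ size s < n, below k s & survivors (k :: s) x]].

Lemma round_dec n j k : j <= k -> round n k `<=` round n j.
Proof.
move=> jk x [s [sn bs [sx kx]]].
have [bj|[s' [ss' bs' s'x]]] := survivors_split j sx.
  by exists s; split => //; split => //; exact: thick_le kx.
by exists s'; split => //; exact: ltn_trans sn.
Qed.

Lemma finite_below n k : finite_set [set s : seq nat | size s < n /\ below k s].
Proof.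
elim: n => [|n IH].
  by rewrite (_ : [set _ | _] = set0) //; apply/seteqP; split => // s [].
apply: (@sub_finite_set _ _
  ([set [::]] `|` (fun p => p.1 :: p.2) @` (`I_k `*`
    [set s : seq nat | size s < n /\ below k s]))).
  move=> [|i s] /=; first by left.
  by move=> [sn /andP[ik bs]]; right; exists (i, s).
rewrite finite_setU; split; first exact: finite_set1.
by apply: finite_image; apply: finite_setX => //; exact: finite_II.
Qed.

Lemma closed_survivors s : closed (survivors s).
Proof.
elim: s => [|m s IH] /=; first exact: closedT.
by apply: closedI => //; exact: (clopen_thick _ _).2.
Qed.

Lemma closed_round n k : closed (round n k).
Proof.
have -> : round n k =
    \bigcup_(s in [set s | size s < n /\ below k s]) survivors (k :: s).
  apply/seteqP; split => [x [s [sn bs sx]]|x [s [sn bs] sx]]; first by exists s.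
  by exists s.
by apply: closed_bigcup; [exact: finite_below | move=> s _; exact: closed_survivors].
Qed.

(** Induction on [n]: splitting at a bound [N] that works for shorter positions leaves only
    positions with all moves below [N]. These are finitely many, and a large last move escapes
    each. *)
Lemma round_escape x n : (forall s, closed (K s) /\ ~ K s x) ->
  exists k, ~ round n k x.
Proof.
move=> Kx; elim: n => [|n [N Nx]]; first by exists 0 => -[s []].
have esc s : exists m, ~ thick m (K s) x.
  by apply/existsNP => sx; apply: (Kx s).2; exact: closed_thickP (Kx s).1 sx.
have [g gP] := choice esc.
have [r rE] := (finite_seqP _).1 (finite_below n.+1 N).
exists (maxn N (\max_(s <- r) g s)) => -[s [sn bs [sx kx]]].
have [bN|[s' [ss' bs' s'x]]] := survivors_split N sx; last first.
  by apply: Nx; exists s'; split => //; exact: leq_trans ss' sn.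
apply: (gP s); apply: thick_le kx; rewrite leq_max; apply/orP; right.
apply: (@leq_bigmax_seq _ r xpredT g) => //.
have : [set s : seq nat | size s < n.+1 /\ below N s] s by [].
by rewrite rE.
Qed.

(** Since [sigma] may fail to increase, the play is split at [sigma n]. *)
Lemma survivors_round sigma n x :
  survivors (past sigma n.+1) x -> round n.+1 (sigma n) x.
Proof.
move=> [/= sx nx].
have [bs|[s' [ss' bs' s'x]]] := survivors_split (sigma n) sx.
  by exists (past sigma n); rewrite size_past.
by exists s'; split => //; apply: leq_trans ss' _; rewrite size_past.
Qed.

Lemma survivors_past sigma x n :
  (forall n, thick (sigma n) (K (past sigma n)) x) -> survivors (past sigma n) x.
Proof. by move=> sx; elim: n => //= n IH; split. Qed.

(** By [round_escape] each [G n] is a compact subset of [A], so the selection property yields [f].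
    By compactness the decreasing closed sets [round n.+1 k] enter [thick (f n) (G n)] at some [k],
    which becomes the move [sigma n]. *)
Lemma shrinkable_game A : shrinkable A ->
    (forall s, compact (K s) /\ K s `<=` A) ->
  exists sigma, \bigcap_n thick (sigma n) (K (past sigma n)) `<=` A.
Proof.
move=> sA KA; pose G n := \bigcap_k round n.+1 k.
have [n|f fA] := sA G.
  split.
    apply: closed_compact_cantor; apply: closed_bigI => k _; exact: closed_round.
  move=> x Gx; apply: contrapT => nAx.
  have [|k kx] := @round_escape x n.+1; last exact/kx/Gx.
  move=> s; split; first by apply: compact_closed_cantor; exact: (KA s).1.
  by move=> /(KA s).2.
have kex n : exists k, round n.+1 k `<=` thick (f n) (G n).
  apply: nested_closed_sub.
  - by move=> k; exact: closed_round.
  - by move=> i j; exact: round_dec.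
  - exact: (clopen_thick _ _).1.
  - exact: thick_sub.
have [sigma sP] := choice kex.
exists sigma => x xs; apply: fA => n _; apply: sP; apply: survivors_round.
by apply: survivors_past => m; exact: xs.
Qed.

End Game.

(** * From the selection property to hereditary Baireness *)

Section ClosedSubspace.
Variables (A : set cantor_space) (Z : set (hyperspace (set_type A))).

Definition timg (z : set_type Z) : set cantor_space := img (set_val z).

Lemma open_thick_radius (V : set (set_type Z)) (z : set_type Z) : open V -> V z ->
  exists m, forall w, thick m (timg w) = thick m (timg z) -> V w.
Proof.
move=> /set_type_openP[B oB BV] Vz.
have : nbhs (set_val z) B.
  by apply: open_nbhs_nbhs; split => //; move: Vz; rewrite -BV.
move=> /nbhs_hyperspaceP[m mB]; exists m => w wz.
by rewrite -BV; exact: mB.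
Qed.

Lemma dense_thick (V : set (set_type Z)) (z : set_type Z) m : dense V ->
  exists2 w, V w & thick m (timg w) = thick m (timg z).
Proof.
move=> dV.
have : nbhs (set_val z) [set L | thick m (img L) = thick m (timg z)].
  exact: nbhs_hyperspace_thick.
rewrite nbhsE => -[Q [oQ Qz] QN].
have [||w [Qw Vw]] := dV (set_val @^-1` Q : set (set_type Z)).
- by exists z.
- by apply/set_type_openP; exists Q.
by exists w => //; exact: QN.
Qed.

End ClosedSubspace.

(** If the intersection missed the cylinder of length [m n] around a point of [K n], some
    [thick (m k) (K k)] would miss it by compactness; but [K (maxn n k)] lies in that thickening and
    meets the cylinder. *)
Lemma thick_limit (K : nat -> set cantor_space) (m : nat -> nat) :
    (forall n, closed (K n)) -> (forall n, m n <= m n.+1) ->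
    (forall n, thick (m n) (K n.+1) = thick (m n) (K n)) ->
  forall n, thick (m n) (\bigcap_j thick (m j) (K j)) = thick (m n) (K n).
Proof.
move=> cK mS mK n; set Q := \bigcap_j _.
have m_le i j : i <= j -> m i <= m j.
  by apply: (homo_leq leqnn (fun _ _ _ => @leq_trans _ _ _)).
have mKj i j : i <= j -> thick (m i) (K j) = thick (m i) (K i).
  elim: j => [|j IH]; first by rewrite leqn0 => /eqP ->.
  rewrite leq_eqVlt => /orP[/eqP -> //|ij]; rewrite -IH //.
  by apply: thick_eq_le (mK j); exact: m_le.
have Kdec i j : i <= j -> thick (m j) (K j) `<=` thick (m i) (K i).
  by move=> ij; rewrite -(mKj i j ij); apply: thick_le; exact: m_le.
apply/seteqP; split => x.
  move=> [q Qq xq]; apply: thick_agree xq _; exact: (Qq n I).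
move=> [y Ky xy]; apply: (thick_agree xy); apply: contrapT => nQy.
have [||||k kQ] := @nested_closed_sub (fun j => thick (m j) (K j)) (~` thick (m n) [set y]).
- by move=> k; exact: (clopen_thick _ _).2.
- exact: Kdec.
- exact: closed_openC (clopen_thick _ _).2.
- by move=> q Qq [z -> qy]; apply: nQy; exists q => //; exact: agree_sym.
have : thick (m n) (K (maxn n k)) y by rewrite mKj ?leq_maxl //; exact: thick_sub.
case=> z Kz yz; apply: (kQ z); last by exists y => //; exact: agree_sym.
by apply: (Kdec k (maxn n k)); [exact: leq_maxr | exact: thick_sub].
Qed.

(** The strategy answers with a point of [Z] in the next [O n] that keeps the trace of the previous
    point up to the last bound. A play lost by it has its limit [Q] inside [A], and the bounds put
    [Q] into [Z], [V] and every [O n]. *)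
Lemma shrinkable_hereditarily_baire A :
  shrinkable A -> hereditarily_baire (hyperspace (set_type A)).
Proof.
move=> sA Z cZ O oO V [z0 Vz0] oV.
have [e0 e0V] := open_thick_radius oV Vz0.
(* [a] holds the round, the current point and the bound up to which its trace is frozen; [p] is the
   next point with a radius that keeps it in the open set of that round. *)
have step_ex (a : nat * (set_type Z) * nat) : exists p : set_type Z * nat,
    [/\ thick a.2 (timg p.1) = thick a.2 (timg a.1.2), a.2 < p.2 &
      forall w, thick p.2 (timg w) = thick p.2 (timg p.1) -> O a.1.1 w].
  case: a => [[n z] m] /=; have [oOn dOn] := oO n.
  have [w Ow wz] := dense_thick z m dOn.
  have [e eO] := open_thick_radius oOn Ow.
  (* [e] secures membership in [O n], and [m.+1] makes the bounds strictly increase, hence the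
     points converge. *)
  exists (w, maxn e m.+1); split => //=; first by rewrite leq_max leqnn orbT.
  move=> u uw; apply: eO; apply: thick_eq_le uw; exact: leq_maxl.
have [step stepP] := choice step_ex.
pose st := fix st (s : seq nat) : set_type Z * nat :=
  if s is m :: s' then step (size s', (st s').1, maxn m (st s').2) else (z0, e0).
have [s|sigma sP] := @shrinkable_game (fun s => timg (st s).1) A sA.
  by split; [exact: compact_img | exact: img_sub].
pose z n := (st (past sigma n)).1; pose e n := (st (past sigma n)).2.
(* [sigma n] brings the limit into [A], [e n] protects the radius reached so far. *)
pose m n := maxn (sigma n) (e n).
have stP n : [/\ thick (m n) (timg (z n.+1)) = thick (m n) (timg (z n)), m n < e n.+1 &
    forall w, thick (e n.+1) (timg w) = thick (e n.+1) (timg (z n.+1)) -> O n w].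
  by have := stepP (n, z n, m n); rewrite /z /e /= size_past.
have em n : e n <= m n by exact: leq_maxr.
have mS n : m n < m n.+1 by have [_ me _] := stP n; exact: leq_trans me (em _).
pose Q := \bigcap_n thick (m n) (timg (z n)).
have QP n : thick (m n) Q = thick (m n) (timg (z n)).
  apply: thick_limit => [i|i|i]; last by have [] := stP i.
    by apply: compact_closed_cantor; exact: compact_img.
  exact: ltnW.
have [L LQ] : exists L : hyperspace (set_type A), img L = Q.
  apply: img_surj.
  - apply: closed_compact_cantor; apply: closed_bigI => n _.
    exact: (clopen_thick _ _).2.
  - move=> x Qx; apply: sP => n _; apply: thick_le (Qx n I); exact: leq_maxl.
  - have [x zx] := img_neq0 (set_val (z 0)).
    have : thick (m 0) Q x by rewrite QP; exact: thick_sub.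
    by case=> y Qy _; exists y.
have ZL : Z L.
  apply: cZ => U /nbhs_hyperspaceP[k kU].
  exists (set_val (z k)); split; first exact: set_valP.
  apply: kU; rewrite LQ; apply/esym.
  apply: thick_eq_le (QP k); exact: (increasing_ge _ mS).
pose w : set_type Z := exist _ L (mem_set ZL).
have wP n k : k <= m n -> thick k (timg w) = thick k (timg (z n)).
  by move=> km; rewrite /timg /= LQ; exact: thick_eq_le (QP n).
exists w; split; first by apply: e0V; exact: (wP 0 e0 (em 0)).
by move=> n _; have [_ _ eO] := stP n; apply: eO; exact: (wP n.+1 _ (em n.+1)).
Qed.

(** * From hereditary Baireness to the selection property *)

Lemma thick_inj (K L : set cantor_space) : closed K -> closed L ->
  (forall m, thick m K = thick m L) -> K = L.
Proof.
move=> cK cL KL; apply/seteqP; split => x Kx; apply: closed_thickP => // m.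
  by rewrite -KL; exact: thick_sub.
by rewrite KL; exact: thick_sub.
Qed.

Lemma hyperspace_separated (A : set cantor_space) (K L : hyperspace (set_type A)) :
  K <> L -> exists m, thick m (img K) <> thick m (img L).
Proof.
move=> KL; apply/existsNP => H; apply: KL; apply: img_inj.
by apply: thick_inj H; apply: compact_closed_cantor; exact: compact_img.
Qed.

Lemma hyperspace_open_neq (A : set cantor_space) (K : hyperspace (set_type A)) :
  open (~` [set K]).
Proof.
rewrite openE => L LK; have [m mLK] := hyperspace_separated LK.
apply/nbhs_hyperspaceP; exists m => M ML MK.
by apply: mLK; rewrite -ML MK.
Qed.

(** * The tree of compact sets *)

Definition remove (i : nat) (x : cantor_space) : cantor_space :=
  fun j => (j != i) && x j.

Section Tree.
Variable C : nat -> set cantor_space.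
Hypotheses (cC : forall n, compact (C n)) (C0 : C 0 !=set0).
Hypothesis CS : forall n, C n `<=` C n.+1.
Hypothesis C_remove : forall n i x, C n x -> C n.+1 (remove i x).

(** Adding the size makes the depth grow strictly along branches even when labels are zero, and the
    sum makes it exceed every label. *)
Definition depth (s : seq nat) := sumn s + size s.

(** The children of [s] contain [node s] and converge to it as their label grows. *)
Fixpoint node (s : seq nat) : set cantor_space :=
  if s is _ :: s' then thick (depth s) (node s') `&` C (size s) else C 0.

Lemma depth_cat t s : depth s <= depth (t ++ s).
Proof. by rewrite /depth sumn_cat size_cat leq_add ?leq_addl. Qed.

Lemma depth_cons m s : depth s < depth (m :: s).
Proof. by rewrite /depth /= addnS ltnS -addnA leq_addl. Qed.

Lemma node_sub s : node s `<=` C (size s).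
Proof. by case: s => // m s x []. Qed.

Lemma closed_node s : closed (node s).
Proof.
case: s => [|m s]; first exact: (compact_closed_cantor (@cC 0)).
apply: (@closedI _ (thick _ _)); first exact: (clopen_thick _ _).2.
exact: (compact_closed_cantor (@cC _)).
Qed.

Lemma node_cons m s : node s `<=` node (m :: s).
Proof. by move=> x sx; split; [exact: thick_sub | exact/CS/node_sub]. Qed.

Lemma node_cat t s : node s `<=` node (t ++ s).
Proof.
elim: t => // m t IH; apply: subset_trans IH _; exact: node_cons.
Qed.

Lemma node_neq0 s : node s !=set0.
Proof. by have [x Cx] := C0; exists x; rewrite -(cats0 s); exact: node_cat. Qed.

Lemma node_cat_thick t m s : node (t ++ m :: s) `<=` thick (depth (m :: s)) (node s).
Proof.
elim: t => [|k t IH] x; first by case.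
move=> [/(thickS IH)/thick_thick + _].
by apply: thick_le; rewrite leq_min leqnn andbT; exact: (depth_cat (k :: t)).
Qed.

Lemma thick_node_cat n t m s : n <= m -> thick n (node (t ++ m :: s)) = thick n (node s).
Proof.
move=> nm; apply/seteqP; split => x.
  move=> /(thickS (@node_cat_thick t m s))/thick_thick; apply: thick_le.
  rewrite leq_min leqnn /depth /=; apply: leq_trans nm _.
  by rewrite -addnA leq_addr.
by apply: thickS; rewrite -cat_rcons; exact: node_cat.
Qed.

(* Were [node (m :: s)] equal to [node s], removing points from [depth] on would
   stay in [node s], and so would the limit, which has finite support. *)
Lemma node_new m s : node (m :: s) = node s -> exists2 x, node s x & finite_set (supp x).
Proof.
move=> E; have [p sp] := node_neq0 s; pose d := depth (m :: s).
have rem i x : d <= i -> node s x -> node s (remove i x).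
  move=> di sx; rewrite -E; split; last exact/C_remove/node_sub.
  exists x => // j jd; rewrite /remove.
  by have -> : j != i by rewrite neq_ltn (leq_trans jd di).
(* [cut j] arises from [p] by removing, one at a time, the points from [d] up to [j], excluding [j];
   it converges to [q]. *)
pose cut j : cantor_space := fun i => ((i < d) || (j <= i)) && p i.
have scut j : d <= j -> node s (cut j).
  elim: j => [|j IH] dj.
    by rewrite (_ : cut 0 = p) //; apply/funext => i; rewrite /cut orbT.
  have [jd|{}dj] := ltnP j d.
    rewrite (_ : cut j.+1 = p) //; apply/funext => i; rewrite /cut.
    have -> : j.+1 = d by apply/eqP; rewrite eqn_leq jd dj.
    by case: ltnP.
  rewrite (_ : cut j.+1 = remove j (cut j)); first by apply: rem => //; exact: IH.
  apply/funext => i; rewrite /cut /remove.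
  case: (eqVneq i j) => [->|ij] /=; first by rewrite ltnn orbF ltnNge dj.
  by rewrite (ltn_neqAle j i) eq_sym ij.
pose q : cantor_space := fun i => (i < d) && p i.
exists q; last first.
  apply: (@sub_finite_set _ _ `I_d); last exact: finite_II.
  by move=> i /andP[].
apply: closed_thickP (@closed_node s) _ => n.
exists (cut (maxn d n)); first by apply: scut; exact: leq_maxl.
move=> i it; rewrite /q /cut; congr (_ && _).
by rewrite [maxn d n <= i]leqNgt leq_max it !orbT orbF.
Qed.

(** A witness in [C n.+1] agrees with [x] far enough to lie in the thickening of [node (b n)], hence
    in [node (b n.+1)]. *)
Lemma branch_limit (b : nat -> seq nat) x :
    b 0 = [::] -> (forall n, exists m, b n.+1 = m :: b n) ->
    (forall n, thick (depth (b n.+1)) (C n) x) ->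
  forall n, thick (depth (b n.+1)) (node (b n)) x.
Proof.
move=> b0 bS bx; have sb n : size (b n) = n.
  by elim: n => [|n IH]; [rewrite b0 | have [m ->] := bS n; rewrite /= IH].
elim=> [|n IH]; first by rewrite b0; exact: (bx 0).
have [y Cy xy] := bx n.+1; exists y => //.
have dS : depth (b n.+1) <= depth (b n.+2).
  by have [m ->] := bS n.+1; exact: (depth_cat [:: m]).
have [m bm] := bS n; rewrite bm /= -bm.
split; last by rewrite sb.
by apply: thick_agree IH; apply: agree_sym; exact: agree_le xy.
Qed.

Section Closed.
Variables (A : set cantor_space) (p : seq nat -> hyperspace (set_type A)).
Hypothesis pE : forall s, img (p s) = node s.

(** If a limit [Q] outside the range adheres to the subtree at [s], it adheres to that of some
    child, since nodes under children with large labels look like [node s], from which [Q] is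
    separated. Along the resulting branch the failure of selection gives a point [x] outside [A],
    yet [x] lies in [Q]. *)
Lemma closed_range_node :
  (forall f : nat -> nat, ~ \bigcap_n thick (f n) (C n) `<=` A) -> closed (range p).
Proof.
move=> nA Q clQ; apply: contrapT => nQ.
have neq s : p s <> Q by move=> sQ; apply: nQ; exists s.
pose T s := forall U, nbhs Q U -> exists t, U (p (t ++ s)).
have T0 : T [::] by move=> U /clQ[_ [[t _ <-] Ut]]; exists t; rewrite cats0.
have Tex s : exists m, T s -> T (m :: s).
  apply: contrapT => /forallNP nT.
  have [Ts nTs] : T s /\ forall m, ~ T (m :: s).
    split; first by have /not_implyP[] := nT 0.
    by move=> m; have /not_implyP[] := nT m.
  have /choice[U UP] : forall m, exists U, nbhs Q U /\ forall t, ~ U (p (t ++ m :: s)).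
    move=> m; have /existsNP[U /not_implyP[QU /forallNP nU]] := nTs m.
    by exists U.
  have [M] := hyperspace_separated (neq s); rewrite pE => MQ.
  have nM k : nbhs Q [set L | forall m, m < k -> U m L].
    elim: k => [|k IH]; first by apply: filterS filterT => L _ m.
    apply: filterS (filterI IH (UP k).1) => L [/= Lk Uk] m.
    by rewrite ltnS leq_eqVlt => /orP[/eqP -> //|/Lk].
  have [t [/= tU]] := Ts _ (filterI (nM M) (nbhs_hyperspace_thick Q M)).
  (* Lists grow at the head, so the last entry of [t] names the child of [s]: labels below [M] are
     excluded by the [U m], the others by [MQ]. *)
  rewrite pE; case/lastP: t tU => [|t m] tU; first exact: MQ.
  have [mM|Mm] := ltnP m M.
    by have := tU m mM; rewrite cat_rcons => /(UP m).2.
  by rewrite cat_rcons thick_node_cat.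
have [next nextP] := choice Tex.
pose b := fix b n := if n is n'.+1 then next (b n') :: b n' else [::].
have Tb n : T (b n) by elim: n => //= n; exact: nextP.
have /existsNP[x /not_implyP[bx nAx]] := nA (fun n => depth (b n.+1)).
apply: nAx; apply: (@img_sub A Q); apply: closed_thickP.
  by apply: compact_closed_cantor; exact: compact_img.
move=> m; have [t] := Tb m _ (nbhs_hyperspace_thick Q m).
rewrite /= pE => <-.
have [|y ny xy] := @branch_limit b x erefl _ (fun n => bx n I) m.
  by move=> n; exists (next (b n)).
exists y; first exact: node_cat.
apply: agree_le xy; elim: m {t y ny} => // m IH.
exact: leq_ltn_trans IH (depth_cons _ _).
Qed.

End Closed.

End Tree.

(** The sets missing at most one number, described by pairs of coordinates so that closedness is
    immediate. *)
Definition cosingletons : set cantor_space :=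
  [set z | forall i j, i != j -> z i || z j].

Lemma compact_cosingletons : compact cosingletons.
Proof.
apply: closed_compact_cantor => z clz i j ij.
have [y [yS yz]] := clz _ (nbhs_agree (maxn i j).+1 z).
by rewrite -!yz ?yS // ltnS ?leq_maxl ?leq_maxr.
Qed.

(* Closing under removal of one point is what makes each node of the tree a
   nontrivial limit of its successors. *)
Fixpoint removal_closure (K : nat -> set cantor_space) n : set cantor_space :=
  if n is n'.+1 then
    pointwise (fun=> andb) @` (removal_closure K n' `*` cosingletons) `|` K n
  else [set fun=> true] `|` K 0.

Section RemovalClosure.
Variables (F : set_system nat) (K : nat -> set cantor_space).
Hypotheses (FF : Filter F) (freeF : free_filter F).
Hypothesis KF : forall n, compact (K n) /\ K n `<=` in_cantor F.

Lemma compact_removal_closure n : compact (removal_closure K n).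
Proof.
elim: n => [|n IH]; apply: compactU; try exact: (KF _).1.
  exact: compact_set1.
exact: compact_pointwise compact_cosingletons.
Qed.

Lemma removal_closure_sub n : removal_closure K n `<=` in_cantor F.
Proof.
elim: n => [|n IH] x [|/(KF _).2 //].
  move=> ->; rewrite /in_cantor /= (_ : supp _ = setT); first exact: filterT.
  by apply/seteqP; split.
move=> [[y z] /= [/IH Fy zS] <-].
have Fz : F (supp z).
  apply: freeF; have [[i zi]|nz] := pselect (exists i, ~~ z i).
    apply: (@sub_finite_set _ _ [set i]); last exact: finite_set1.
    move=> j zj; apply/eqP; apply/negPn/negP => ji.
    by have := zS j i ji; rewrite (negbTE zi) orbF => /zj.
  rewrite (_ : ~` supp z = set0) //; apply/seteqP; split => // i zi.
  by apply: nz; exists i; apply/negP.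
apply: filterS (filterI Fy Fz) => i [/= yi zi]; exact/andP.
Qed.

Lemma removal_closure_le n : removal_closure K n `<=` removal_closure K n.+1.
Proof.
move=> x Kx; left; exists (x, fun=> true); first by split.
by apply/funext => i; rewrite /pointwise /= andbT.
Qed.

Lemma removal_closure_remove n i x :
  removal_closure K n x -> removal_closure K n.+1 (remove i x).
Proof.
move=> Kx; left; exists (x, fun j => j != i).
  split => //= j k /=; case: (eqVneq j i) => // ->; by rewrite eq_sym.
by apply/funext => j; rewrite /pointwise /remove /= andbC.
Qed.

Lemma sub_removal_closure n : K n `<=` removal_closure K n.
Proof. by case: n => [|n] x Kx; right. Qed.

End RemovalClosure.

Lemma not_finite_supp (F : set_system nat) x : ProperFilter F -> free_filter F ->
  in_cantor F x -> ~ finite_set (supp x).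
Proof.
move=> FF freeF Fx fx; apply: (@filter_not_empty _ F).
rewrite -(setICr (supp x)); apply: filterI => //; apply: freeF.
by rewrite setCK.
Qed.

(** For the removal closures of a counterexample the nodes form a countable closed subspace. Each
    node is the limit of its children, which differ from it by [node_new] because members of [F] are
    infinite. So the complements of single nodes are open and dense, with empty intersection. *)
Lemma hereditarily_baire_shrinkable (F : set_system nat) :
    ProperFilter F -> free_filter F ->
  hereditarily_baire (hyperspace (set_type (in_cantor F))) ->
  shrinkable (in_cantor F).
Proof.
move=> FF freeF hB K KF; apply: contrapT => /forallNP nK.
pose C := removal_closure K.
have cC n : compact (C n) by exact: (@compact_removal_closure F).
have CF n : C n `<=` in_cantor F by exact: removal_closure_sub.
(* [K 0] may be empty; the full set was added to stage 0 for this. *)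
have C0 : C 0 !=set0 by exists (fun=> true); left.
have CS n : C n `<=` C n.+1 by exact: removal_closure_le.
have CR n i x : C n x -> C n.+1 (remove i x) by exact: removal_closure_remove.
have node_ex s : exists L : hyperspace (set_type (in_cantor F)), img L = node C s.
  apply: img_surj.
  - by apply: closed_compact_cantor; exact: closed_node.
  - by apply: subset_trans (@node_sub C s) _; exact: CF.
  - exact: node_neq0.
have [p pE] := choice node_ex.
have cZ : closed (range p).
  apply: (closed_range_node CS pE) => f fC; apply: (nK f) => x fx.
  by apply: fC => n _; apply: thickS (fx n I); exact: sub_removal_closure.
(* [B k] omits the node with code [k], and nothing if [k] codes no list. *)
pose B k := [set z : set_type (range p) |
  forall s, choice.unpickle k = Some s -> set_val z <> p s].
have [|||z [_ Bz]] := hB _ cZ B _ setT.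
- move=> k; split.
    case E : (choice.unpickle k) => [s|]; last first.
      rewrite (_ : B k = setT); first exact: openT.
      by apply/seteqP; split => // z _ s; rewrite E.
    apply/set_type_openP; exists (~` [set p s]); first exact: hyperspace_open_neq.
    apply/seteqP; split => z /=; first by move=> zs t; rewrite E => -[<-].
    by move=> /(_ s E).
  move=> V [z Vz] oV; have [Bz|nBz] := pselect (B k z); first by exists z.
  have [s [ks zs]] : exists s, choice.unpickle k = Some s /\ set_val z = p s.
    move: nBz => /existsNP[s /not_implyP[ks /contrapT zs]]; by exists s.
  have [m mV] := open_thick_radius oV Vz.
  have pr : range p (p (m :: s)) by exists (m :: s).
  exists (@exist _ (fun L => L \in range p) _ (mem_set pr)); split.
    apply: mV; rewrite /timg zs /= !pE.
    exact: (@thick_node_cat C CS m [::] m s).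
  move=> t; rewrite ks => -[<-] /(congr1 (@img _)); rewrite /= !pE.
  move=> /(node_new cC C0 CS CR)[x sx]; apply: (not_finite_supp FF freeF).
  by apply: CF; exact: (node_sub sx).
- have pr : range p (p [::]) by exists [::].
  by exists (@exist _ (fun L => L \in range p) _ (mem_set pr)).
- exact: openT.
have [s _ zs] := set_valP z.
exact: Bz (choice.pickle s) I s (choice.pickleK s) (esym zs).
Qed.

(** * Density and the cycle of implications *)

Lemma dense_in_cantor (F : set_system nat) : free_filter F -> dense (in_cantor F).
Proof.
move=> freeF O [x Ox] oO.
have : nbhs x O by exact: open_nbhs_nbhs.
(* Adding all numbers from [m] on gives a cofinite set in the same cylinder of length [m]. *)
move=> /nbhs_cantorP[m mO]; exists (fun i => (m <= i) || x i); split.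
  by apply: mO => i im; rewrite leqNgt im.
apply: freeF; apply: (@sub_finite_set _ _ `I_m); last exact: finite_II.
by move=> i; rewrite /supp /= => /negP; rewrite negb_or -ltnNge => /andP[].
Qed.

Theorem theorem4p4 (F : set_system nat) (FF : ProperFilter F)
    (freeF : free_filter F) :
  [<-> strong_P_filter F;
       menger_at_infinity (set_type (in_cantor F));
       hereditarily_baire (hyperspace (set_type (in_cantor F)));
       menger (set_type (in_cantor (positive F)))].
Proof.
(* Density makes the Cantor space a compactification of the filter, and serves again when an
   arbitrary compactification is given. *)
have dF := dense_in_cantor freeF.
split; first by move=> /strong_P_shrinkable; exact: shrinkable_menger_at_infinity.
split.
  by move=> /(menger_at_infinity_shrinkable dF); exact: shrinkable_hereditarily_baire.
split.
  by move=> /(hereditarily_baire_shrinkable FF freeF); exact: shrinkable_menger_positive.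
by move=> /menger_positive_shrinkable; exact: shrinkable_strong_P.
Qed.
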